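(* Let $S$ be a multiplicatively closed subset of a commutative ring $R$ with identity such that $S\subseteq reg(R)$, let $M$ be a unital $R$-module, and let $N$ be a submodule of $M$. (1) If $N$ is a semi $n$-submodule of $M$ and $\bigcup_{s\in S}(N:_{M}s)\neq M$, then $S^{-1}N$ is a semi $n$-submodule of the $S^{-1}R$-module $S^{-1}M$. (2) If $S^{-1}N$ is a semi $n$-submodule of the $S^{-1}R$-module $S^{-1}M$ and $S\cap Z_{N}(M)=\emptyset$, then $N$ is a semi $n$-submodule of $M$.
   Context: $reg(R)$ is the set of regular elements (non-zero-divisors) of $R$. $(N:_M s)=\{m\in M: sm\in N\}$. $Z_N(M)=\{r\in R: rm\in N \text{ for some } m\in M\setminus N\}$. For a commutative ring $A$ with nilradical $\sqrt{0_A}$ and an $A$-module $X$, a proper submodule $Y$ of $X$ is called a semi $n$-submodule if whenever $a\in A$, $x\in X$ with $a^{2}x\in Y$, $a\notin\sqrt{0_A}$ and $Ann_A(x)=\{b\in A: bx=0\}=0$, then $ax\in Y$. *)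

(* Defs.v *)
From HB Require Import structures.
From mathcomp Require Export all_boot all_algebra.
From mathcomp Require Export boolp classical_sets.
From mathcomp Require Import ring.

Set Implicit Arguments.
Unset Strict Implicit.
Unset Printing Implicit Defensive.

Import GRing.Theory.

Local Open Scope classical_set_scope.
Local Open Scope ring_scope.
Local Open Scope quotient_scope.

(* Rings are [comPzRingType]: the zero ring is allowed, so that the
   localization is a ring even when [0 \in S].  With classical axioms every
   subset has a boolean characteristic predicate, so [mulrClosed R]
   (containing 1, closed under products) and [submodClosed X] range over all
   multiplicatively closed subsets and all submodules. *)

Section Ideals.
Variable A : comPzRingType.

Definition reg : set A := [set r | forall x : A, r * x = 0 -> x = 0].

Definition nilradical : set A := [set a | exists n : nat, a ^+ n = 0].

Variable X : lmodType A.

Definition ann (x : X) : set A := [set b | b *: x = 0].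

Definition colon (N : submodClosed X) (s : A) : set X :=
  [set m | s *: m \in N].

Definition zdiv (N : submodClosed X) : set A :=
  [set r | exists2 m : X, m \notin N & r *: m \in N].

Definition semi_n_submodule (Y : submodClosed X) : Prop :=
  [set` Y] <> [set: X] /\
  forall (a : A) (x : X),
    a ^+ 2 *: x \in Y -> ~ nilradical a -> ann x = [set 0] -> a *: x \in Y.

End Ideals.

Arguments reg A : clear implicits.
Arguments nilradical A : clear implicits.


Section Denominators.
Variables (R : comPzRingType) (S : mulrClosed R).

Definition den : Type := {s : R | s \in S}.
HB.instance Definition _ := Choice.on den.

Definition dval (s : den) : R := sval s.
Definition den1 : den := exist _ 1 (rpred1 S).
Definition denM (s t : den) : den :=
  exist _ (dval s * dval t) (rpredM (svalP s) (svalP t)).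

Lemma dval1 : dval den1 = 1. Proof. by []. Qed.
Lemma dvalM s t : dval (denM s t) = dval s * dval t. Proof. by []. Qed.
Lemma dvalP s : dval s \in S. Proof. exact: (svalP s). Qed.

End Denominators.
Arguments dval : simpl never.
Arguments den1 {R S}.

Section LocalizedModule.
Variables (R : comPzRingType) (S : mulrClosed R) (M : lmodType R).
Local Notation den := (den S).
Implicit Types (m n : M) (s t u : den).

(* (m, s) ~ (n, t) iff u t m = u s n for some u in S. *)
Definition loc_eq (x y : M * den) : bool :=
  `[< exists u : den,
        (dval u * dval y.2) *: x.1 = (dval u * dval x.2) *: y.1 >].

Fact loc_eq_refl : reflexive loc_eq.
Proof. by move=> x; apply/asboolP; exists den1. Qed.

Fact loc_eq_sym : symmetric loc_eq.
Proof. by move=> x y; apply/asboolP/asboolP => -[u e]; exists u. Qed.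

Fact loc_eq_trans : transitive loc_eq.
Proof.
move=> [n t] [m s] [p v] /asboolP[u /= e] /asboolP[w /= f].
apply/asboolP; exists (denM (denM u w) t); rewrite !dvalM /=.
have -> : dval u * dval w * dval t * dval v = dval w * dval v * (dval u * dval t)
  by ring.
have -> : dval u * dval w * dval t * dval s = dval u * dval s * (dval w * dval t)
  by ring.
by rewrite -scalerA e scalerA -[RHS]scalerA -f scalerA mulrC.
Qed.

Canonical loc_equiv := EquivRel loc_eq loc_eq_refl loc_eq_sym loc_eq_trans.

Definition locmod : Type := {eq_quot loc_eq}.
HB.instance Definition _ := Choice.on locmod.
HB.instance Definition _ : EqQuotient _ loc_eq locmod := EqQuotient.on locmod.

(* The fraction m / s; [loc_oppE], [loc_addE], [loc_scaleE] and [loc_mulE]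
   give the usual formulas for the operations, which are defined below
   through chosen representatives. *)
Definition lfrac (m : M) (s : den) : locmod := \pi_locmod (m, s).

Lemma lfracP m s n t :
  lfrac m s = lfrac n t <->
  exists u : den, (dval u * dval t) *: m = (dval u * dval s) *: n.
Proof.
split=> [/eqmodP/asboolP //|e].
by apply/eqmodP/asboolP.
Qed.

Lemma lfrac_repr (x : locmod) : lfrac (repr x).1 (repr x).2 = x.
Proof. by rewrite /lfrac -surjective_pairing reprK. Qed.

Lemma lfrac_surj (x : locmod) : exists m s, x = lfrac m s.
Proof. by exists (repr x).1, (repr x).2; rewrite lfrac_repr. Qed.

Lemma repr_lfrac m s : exists u : den,
  (dval u * dval s) *: (repr (lfrac m s)).1 =
  (dval u * dval (repr (lfrac m s)).2) *: m.
Proof. by apply/lfracP; rewrite lfrac_repr. Qed.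

Definition loc0 : locmod := lfrac 0 den1.

Definition loc_opp (x : locmod) : locmod := lfrac (- (repr x).1) (repr x).2.

Definition loc_add (x y : locmod) : locmod :=
  lfrac (dval (repr y).2 *: (repr x).1 + dval (repr x).2 *: (repr y).1)
        (denM (repr x).2 (repr y).2).

Lemma loc_oppE m s : loc_opp (lfrac m s) = lfrac (- m) s.
Proof.
apply/lfracP; have [u e] := repr_lfrac m s.
by exists u; rewrite !scalerN e.
Qed.

Lemma loc_addE m s n t :
  loc_add (lfrac m s) (lfrac n t) =
  lfrac (dval t *: m + dval s *: n) (denM s t).
Proof.
apply/lfracP; have [u e] := repr_lfrac m s; have [w f] := repr_lfrac n t.
move: e f; set x := repr _; set y := repr _ => e f.
exists (denM u w); rewrite !dvalM /= !scalerDr !scalerA.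
congr (_ + _).
  have -> : dval u * dval w * (dval s * dval t) * dval y.2 =
            (dval w * dval t * dval y.2) * (dval u * dval s) by ring.
  by rewrite -scalerA e scalerA; congr (_ *: _); ring.
have -> : dval u * dval w * (dval s * dval t) * dval x.2 =
          (dval u * dval s * dval x.2) * (dval w * dval t) by ring.
by rewrite -scalerA f scalerA; congr (_ *: _); ring.
Qed.

Fact loc_addA : associative loc_add.
Proof.
move=> x y z; have [m [s ->]] := lfrac_surj x.
have [n [t ->]] := lfrac_surj y; have [p [v ->]] := lfrac_surj z.
rewrite !loc_addE; apply/lfracP; exists den1.
rewrite !(dvalM, dval1) !scalerDr !scalerA addrA; congr (_ *: _ + _ *: _ + _ *: _); ring.
Qed.

Fact loc_addC : commutative loc_add.
Proof.
move=> x y; have [m [s ->]] := lfrac_surj x; have [n [t ->]] := lfrac_surj y.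
rewrite !loc_addE; apply/lfracP; exists den1.
by rewrite !(dvalM, dval1) [_ *: m + _]addrC [dval s * _]mulrC.
Qed.

Fact loc_add0 : left_id loc0 loc_add.
Proof.
move=> x; have [m [s ->]] := lfrac_surj x; rewrite loc_addE.
by apply/lfracP; exists den1; rewrite !(dvalM, dval1) scaler0 add0r !mul1r scale1r.
Qed.

Fact loc_addN : left_inverse loc0 loc_opp loc_add.
Proof.
move=> x; have [m [s ->]] := lfrac_surj x; rewrite loc_oppE loc_addE.
by apply/lfracP; exists den1; rewrite !(dvalM, dval1) scalerN addNr !scaler0.
Qed.

HB.instance Definition _ :=
  GRing.isZmodule.Build locmod loc_addA loc_addC loc_add0 loc_addN.

Lemma lfrac0 : lfrac 0 den1 = 0. Proof. by []. Qed.

Lemma lfracD m s n t :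
  lfrac m s + lfrac n t = lfrac (dval t *: m + dval s *: n) (denM s t).
Proof. exact: loc_addE. Qed.

End LocalizedModule.

Arguments lfrac {R} S {M} m s.

(* S^-1 R is the localization of R as a module over itself; the copy of the
   type carries the ring structure. *)
Section LocalizedRing.
Variables (R : comPzRingType) (S : mulrClosed R).
Local Notation den := (den S).
Implicit Types (a b : R) (s t : den).

Definition locring : Type := locmod S R^o.
HB.instance Definition _ := GRing.Zmodule.on locring.

Definition rfrac (a : R) (s : den) : locring := lfrac S (a : R^o) s.

Lemma rfracP a s b t :
  rfrac a s = rfrac b t <->
  exists u : den, dval u * dval t * a = dval u * dval s * b.
Proof. exact: (@lfracP R S R^o). Qed.

Lemma rfrac_surj (x : locring) : exists a s, x = rfrac a s.
Proof. exact: (@lfrac_surj R S R^o). Qed.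

Lemma rfracD a s b t :
  rfrac a s + rfrac b t = rfrac (dval t * a + dval s * b) (denM s t).
Proof. exact: (@lfracD R S R^o). Qed.

Section Scale.
Variable M : lmodType R.

Definition loc_scale (a : locring) (x : locmod S M) : locmod S M :=
  lfrac S (((repr a).1 : R) *: (repr x).1) (denM (repr a).2 (repr x).2).

Lemma loc_scaleE a s (m : M) t :
  loc_scale (rfrac a s) (lfrac S m t) = lfrac S (a *: m) (denM s t).
Proof.
apply/lfracP; have [u e] := repr_lfrac (a : R^o) s.
have [w f] := repr_lfrac m t.
move: e f; rewrite -/(rfrac a s).
case: (repr (rfrac a s)) => b v; case: (repr _) => n z /= e f.
exists (denM u w); rewrite !dvalM /= !scalerA.
have {}e : dval u * dval s * b = dval u * dval v * a by exact: e.
have -> : dval u * dval w * (dval s * dval t) * b =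
          (dval u * dval s * b) * (dval w * dval t) by ring.
by rewrite -scalerA f scalerA e; congr (_ *: _); ring.
Qed.

End Scale.

Definition loc_mul (x y : locring) : locring := @loc_scale R^o x y.

Lemma loc_mulE a s b t :
  loc_mul (rfrac a s) (rfrac b t) = rfrac (a * b) (denM s t).
Proof. exact: (@loc_scaleE R^o). Qed.

Fact loc_mulA : associative loc_mul.
Proof.
move=> x y z; have [a [s ->]] := rfrac_surj x.
have [b [t ->]] := rfrac_surj y; have [c [v ->]] := rfrac_surj z.
by rewrite !loc_mulE; apply/rfracP; exists den1; rewrite !(dvalM, dval1); ring.
Qed.

Fact loc_mulC : commutative loc_mul.
Proof.
move=> x y; have [a [s ->]] := rfrac_surj x; have [b [t ->]] := rfrac_surj y.
by rewrite !loc_mulE; apply/rfracP; exists den1; rewrite !(dvalM, dval1); ring.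
Qed.

Fact loc_mul1 : left_id (rfrac 1 den1) loc_mul.
Proof.
move=> x; have [a [s ->]] := rfrac_surj x.
by rewrite !loc_mulE; apply/rfracP; exists den1; rewrite !(dvalM, dval1); ring.
Qed.

Fact loc_mulDl : left_distributive loc_mul +%R.
Proof.
move=> x y z; have [a [s ->]] := rfrac_surj x.
have [b [t ->]] := rfrac_surj y; have [c [v ->]] := rfrac_surj z.
rewrite !(loc_mulE, rfracD); apply/rfracP; exists den1; rewrite !(dvalM, dval1); ring.
Qed.

HB.instance Definition _ := GRing.Zmodule_isComPzRing.Build locring
  loc_mulA loc_mulC loc_mul1 loc_mulDl.

Lemma rfrac1 : rfrac 1 den1 = 1. Proof. by []. Qed.

Lemma rfracM a s b t : rfrac a s * rfrac b t = rfrac (a * b) (denM s t).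
Proof. exact: loc_mulE. Qed.

End LocalizedRing.

Section LocalizedModuleStructure.
Variables (R : comPzRingType) (S : mulrClosed R) (M : lmodType R).
Local Notation den := (den S).
Local Notation scale := (@loc_scale R S M).

Fact loc_scaleA (a b : locring S) (x : locmod S M) :
  scale a (scale b x) = scale (a * b) x.
Proof.
have [r [s ->]] := rfrac_surj a; have [q [t ->]] := rfrac_surj b.
have [m [v ->]] := lfrac_surj x; rewrite rfracM !loc_scaleE.
apply/lfracP; exists den1; rewrite !(dvalM, dval1) !scalerA; congr (_ *: _); ring.
Qed.

Fact loc_scale1 : left_id 1 scale.
Proof.
move=> x; have [m [v ->]] := lfrac_surj x; rewrite -rfrac1 loc_scaleE.
by apply/lfracP; exists den1; rewrite !(dvalM, dval1) !mul1r scale1r.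
Qed.

Fact loc_scaleDr : right_distributive scale +%R.
Proof.
move=> a x y; have [r [s ->]] := rfrac_surj a.
have [m [t ->]] := lfrac_surj x; have [n [v ->]] := lfrac_surj y.
rewrite !(loc_scaleE, lfracD); apply/lfracP; exists den1.
rewrite !(dvalM, dval1) !scalerDr !scalerA; congr (_ *: _ + _ *: _); ring.
Qed.

Fact loc_scaleDl (x : locmod S M) :
  {morph scale^~ x : a b / a + b >-> a + b}.
Proof.
move=> a b; have [r [s ->]] := rfrac_surj a; have [q [t ->]] := rfrac_surj b.
have [m [v ->]] := lfrac_surj x; rewrite rfracD !loc_scaleE lfracD.
apply/lfracP; exists den1.
rewrite !(dvalM, dval1) !scalerDr !scalerA -scalerDl; congr (_ *: _); ring.
Qed.

HB.instance Definition _ := GRing.Zmodule_isLmodule.Build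
  (locring S) (locmod S M) loc_scaleA loc_scale1 loc_scaleDr loc_scaleDl.

Lemma lfracZ (r : R) (s : den) (m : M) (t : den) :
  rfrac r s *: lfrac S m t = lfrac S (r *: m) (denM s t).
Proof. exact: loc_scaleE. Qed.

(* S^-1 N = { n / s | n in N, s in S }. *)
Definition locsub (N : submodClosed M) : {pred locmod S M} :=
  [pred x | `[< exists n : M, exists2 s : den, n \in N & x = lfrac S n s >]].

Lemma locsubP (N : submodClosed M) (x : locmod S M) :
  reflect (exists n : M, exists2 s : den, n \in N & x = lfrac S n s)
          (x \in locsub N).
Proof. exact: asboolP. Qed.

Variable N : submodClosed M.

Fact locsub_closed : GRing.subsemimod_closed (locsub N).
Proof.
split; first split; first by apply/locsubP; exists 0, den1; rewrite ?rpred0.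
- move=> _ _ /locsubP[m [s Nm ->]] /locsubP[n [t Nn ->]].
  apply/locsubP; exists (dval t *: m + dval s *: n), (denM s t) => //.
    by rewrite rpredD ?rpredZ.
  exact: lfracD.
- move=> a _ /locsubP[n [t Nn ->]]; have [r [s ->]] := rfrac_surj a.
  by apply/locsubP; exists (r *: n), (denM s t); rewrite ?rpredZ // lfracZ.
Qed.

HB.instance Definition _ :=
  GRing.isSubSemiModClosed.Build (locring S) (locmod S M) (locsub N)
    locsub_closed.

End LocalizedModuleStructure.

Arguments locsub {R} S {M} N.

(* Main.v *)
Require Import Defs.

Local Open Scope classical_set_scope.
Local Open Scope ring_scope.

Import GRing.Theory.

(** Membership of a fraction [m / s] in [S^-1 N] and its vanishing are both
    witnessed by a single denominator [u]: [u m \in N], resp. [u m = 0].  When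
    [S] consists of regular elements, [a / s] is nilpotent iff [a] is, and
    [m / s] has zero annihilator iff [m] does.  In (1) the hypothesis on [N] is
    applied to [u x], which still has zero annihilator since [u] is regular; in
    (2) the denominator [u] with [u a x \in N] is cancelled because it is not
    in [Z_N(M)]. *)

Section Fractions.
Variables (R : comPzRingType) (S : mulrClosed R) (M : lmodType R).
Implicit Types (a : R) (m : M) (s u : den S) (N : submodClosed M).

Lemma lfrac_mem N m s :
  lfrac S m s \in locsub S N <-> exists u, dval u *: m \in N.
Proof.
split=> [/locsubP[n [t Nn /lfracP[u e]]] | [u Num]].
  by exists (denM u t); rewrite dvalM e rpredZ.
apply/locsubP; exists (dval u *: m), (denM u s) => //.
by apply/lfracP; exists den1; rewrite !(dvalM, dval1) !mul1r scalerA mulrC.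
Qed.

Lemma lfrac_eq0 m s : lfrac S m s = 0 <-> exists u, dval u *: m = 0.
Proof.
rewrite -lfrac0; split=> [/lfracP[u] | [u um0]].
  by rewrite dval1 mulr1 scaler0; exists u.
by apply/lfracP; exists u; rewrite dval1 mulr1 scaler0.
Qed.

(** The denominator is left existential because only the vanishing of the power is tested later. *)
Lemma rfracX a s n : exists t, rfrac a s ^+ n = rfrac (a ^+ n) t.
Proof.
elim: n => [|n [t IHn]]; first by exists den1; rewrite !expr0 rfrac1.
by exists (denM s t); rewrite !exprS IHn rfracM.
Qed.

Hypothesis SregR : [set` S] `<=` reg R.

Lemma dval_reg u : reg R (dval u).
Proof. exact/SregR/dvalP. Qed.

Lemma rfrac_eq0 a s : rfrac a s = 0 <-> a = 0.
Proof.
(* Zero is written as [0 / 1], so that equality of fractions yields [u a = 0] with [u] regular. *)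
rewrite -[0 in X in X <-> _](@lfrac0 R S R^o); split=> [/rfracP[u] | ->].
  by rewrite dval1 mulr1 mulr0 => /dval_reg.
by apply/rfracP; exists den1; rewrite !mulr0.
Qed.

Lemma nilradical_rfrac a s : nilradical (locring S) (rfrac a s) <-> nilradical R a.
Proof.
by split=> -[n an0]; exists n; have [t e] := rfracX a s n;
  move: an0; rewrite /= e rfrac_eq0.
Qed.

Lemma ann_eq0P (A : comPzRingType) (X : lmodType A) (x : X) :
  ann x = [set 0] <-> forall b : A, b *: x = 0 -> b = 0.
Proof.
split=> [annx b bx0 | annx].
  by have : ann x b by []; rewrite annx.
by apply/seteqP; split=> b /= => [/annx | ->] //; rewrite /ann /= scale0r.
Qed.

Lemma ann_scale_reg a m : reg R a -> ann m = [set 0] -> ann (a *: m) = [set 0].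
Proof.
move=> rega /ann_eq0P annm; apply/ann_eq0P => b.
by rewrite scalerA mulrC => /annm /rega.
Qed.

Lemma ann_lfrac m s : ann (lfrac S m s) = [set 0] <-> ann m = [set 0].
Proof.
split=> /ann_eq0P annm; apply/ann_eq0P => b.
  (* If [b] kills [m], then [b / 1] kills [m / s]. *)
  move=> bm0; apply/(rfrac_eq0 b den1)/annm.
  by rewrite lfracZ bm0; apply/lfrac_eq0; exists den1; rewrite scaler0.
have [r [t ->]] := rfrac_surj b; rewrite lfracZ => /lfrac_eq0[u].
by rewrite scalerA => /annm /dval_reg r0; apply/rfrac_eq0.
Qed.

End Fractions.

Theorem theorem5 (R : comPzRingType) (S : mulrClosed R) (M : lmodType R)
    (N : submodClosed M) (SregR : [set` S] `<=` reg R) :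
  (semi_n_submodule N ->
   \bigcup_(s in [set` S]) colon N s <> [set: M] ->
   semi_n_submodule (locsub S N))
  /\
  (semi_n_submodule (locsub S N) ->
   [set` S] `&` zdiv N = set0 ->
   semi_n_submodule N).
Proof.
split=> [[_ semiN] colonN | [locN semilN] SzdivN]; split.
(* If [S^-1 N] were everything, each [m / 1] would put [m] in some colon submodule. *)
- move=> locT; apply: colonN; apply/seteqP; split=> // m _.
  have : lfrac S m den1 \in locsub S N.
    by have : [set: locmod S M] (lfrac S m den1) by []; rewrite -locT.
  by move/lfrac_mem=> [u Num]; exists (dval u); rewrite //=; apply: dvalP.
- move=> a x; have [r [s ->]] := rfrac_surj a; have [m [t ->]] := lfrac_surj x.
  rewrite expr2 rfracM lfracZ lfrac_mem nilradical_rfrac // ann_lfrac //.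
  move=> [u Nurm] nilr annm; rewrite lfracZ; apply/lfrac_mem; exists u.
  (* The scalars are swapped to apply the hypothesis to [r] and [u m]. *)
  rewrite scalerA mulrC -scalerA; apply: semiN => //.
    by rewrite scalerA mulrC -scalerA expr2.
  by apply: ann_scale_reg annm; apply: dval_reg.
- move=> NT; apply: locN; apply/seteqP; split=> // x _ /=.
  have [m [s ->]] := lfrac_surj x; apply/lfrac_mem; exists den1.
  by rewrite rpredZ //; have : [set: M] m by []; rewrite -NT.
- move=> a m Nam nila annm.
  (* The hypothesis on [S^-1 N] is used at [a / 1] and [m / 1]; the denominator [1 * 1] is that of
     their product. *)
  have /lfrac_mem[u Nuam] : lfrac S (a *: m) (denM den1 den1) \in locsub S N.
    rewrite -lfracZ; apply: semilN; rewrite ?nilradical_rfrac ?ann_lfrac //.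
    by rewrite expr2 rfracM lfracZ; apply/lfrac_mem; exists den1; rewrite rpredZ.
  (* Otherwise [a m] would witness that [u] lies in [zdiv N]. *)
  apply: contrapT => /negP NNam; suff : set0 (dval u) by [].
  by rewrite -SzdivN; split; [exact: dvalP | exists (a *: m)].
Qed.
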